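(* Let $n\ge1$, let $\gamma_1,\dots,\gamma_n$ be independent standard Gaussian variables, $b_i=\operatorname{sgn}\gamma_i$, and for $\theta\in T=\{-1,1\}^n$ put $$a_i^\theta=\theta_i\prod_{k<i}\mathbf 1_{\{\theta_k=b_k\}},\qquad X_j^\theta=\sum_{i\le j}a_i^\theta\gamma_i,\qquad d(\theta,\theta')=\Big(\sum_{i=1}^n|a_i^\theta-a_i^{\theta'}|^2\Big)^{1/2}.$$ Then $$\mathbb E\sup_{\theta\in T}|X_n^\theta|=\sqrt{2/\pi}\;n,\qquad \mathbb E\max_{\theta,\theta'\in T}|X_n^\theta-X_n^{\theta'}|\ge\sqrt{2/\pi}\;n,$$ whereas there are a numerical constant $C'$ (independent of $n$) and a random full-support probability measure $\mu_\omega$ on $T$ (depending on $\gamma_1,\dots,\gamma_n$) such that almost surely $\Gamma_{\mu_\omega}(d_\omega)\le C'\sqrt n$. Consequently there is no universal constant $C$ such that $$\mathbb E\max_{0\le j\le N}\operatorname{osc}_Tf_j\le C\,\mathbb E\inf_{\mu}\Gamma_\mu(d_\omega)$$ holds for all families $f_j(t)=\sum_{i\le j}A_i(t)\gamma_i$ of real-valued predictable Gaussian sums indexed by a finite set $T$, where the infimum is taken, separately for each outcome $\omega$, over all full-support probability measures $\mu$ on $T$.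
   Context: Real-valued predictable Gaussian sums: $(\mathcal F_j)_{j=0}^N$ is a filtration; for $i=1,\dots,N$, $\gamma_i$ is a standard Gaussian variable independent of $\mathcal F_{i-1}$ and $\mathcal F_i$-measurable; $A_i(t)$ ($t\in T$) are real $\mathcal F_{i-1}$-measurable random variables; $f_0(t)=0$, $f_j(t)=\sum_{i\le j}A_i(t)\gamma_i$. The terminal square-function pseudometric is $d(t,u)=\big(\sum_{i=1}^N|A_i(t)-A_i(u)|^2\big)^{1/2}$, and $\operatorname{osc}_Tf_j=\max_{t,u\in T}|f_j(t)-f_j(u)|$. For a pseudometric $d$ and a full-support probability measure $\mu$ on a finite set $T$: $\Delta_d=\max_{t,u\in T}d(t,u)$, $B_d(t,r)=\{u\in T:d(t,u)\le r\}$, and $\Gamma_\mu(d)=\sup_{t\in T}\int_0^{\Delta_d}\sqrt{\log\frac{e}{\mu(B_d(t,r))}}\,dr$. Empty products equal $1$. *)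

(* Defs.v *)
From HB Require Import structures.
From mathcomp Require Import all_boot all_order all_algebra.
From mathcomp Require Import all_classical all_reals all_analysis.

Set Implicit Arguments.
Unset Strict Implicit.
Unset Printing Implicit Defensive.

Import Order.TTheory GRing.Theory Num.Theory.
Import numFieldNormedType.Exports.

Local Open Scope classical_set_scope.
Local Open Scope ring_scope.

(* Indices i = 1, ..., N of the mathematics are the ordinals 0, ..., N - 1;
   time indices j = 0, ..., N keep their values.  The sum over i <= j is thus
   the sum over the ordinals i < j, and F_{i-1}, F_i become F i, F i.+1. *)

(* Maxima of nonnegative quantities over finite index types are taken with
   neutral element 0; all index types used are nonempty. *)

Section Finite.
Context {R : realType} {T : finType}.

(* A probability measure on the finite set T is given by its point masses. *)
Definition full_support_prob (m : T -> R) : Prop :=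
  (forall t, 0 < m t) /\ \sum_t m t = 1.

Definition diam (d : T -> T -> R) : R :=
  \big[Num.max/0]_(t : T) \big[Num.max/0]_(u : T) d t u.

Definition ball_mass (m : T -> R) (d : T -> T -> R) (t : T) (r : R) : R :=
  \sum_(u : T | d t u <= r) m u.

Definition GammaF (m : T -> R) (d : T -> T -> R) : \bar R :=
  ereal_sup [set (\int[lebesgue_measure]_(r in `[0%R, diam d])
      (Num.sqrt (ln (expR 1 / ball_mass m d t r)))%:E)%E | t in [set: T]].

Definition osc (h : T -> R) : R :=
  \big[Num.max/0]_(t : T) \big[Num.max/0]_(u : T) `|h t - h u|.

Definition sqdist N (a : T -> 'I_N -> R) (t u : T) : R :=
  Num.sqrt (\sum_(i < N) `|a t i - a u i| ^+ 2).

Definition psum N (a : T -> 'I_N -> R) (g : 'I_N -> R) (j : nat) (t : T) : R :=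
  \sum_(i < N | (i < j)%N) a t i * g i.

End Finite.

Section Probability.
Context {d : measure_display} {Omega : measurableType d} {R : realType}.
Variable P : probability Omega R.

Definition std_gaussian (X : {RV P >-> R}) : Prop :=
  forall B : set R, measurable B -> distribution P X B = normal_prob 0 1 B.

Definition mutually_independent n (X : 'I_n -> {RV P >-> R}) : Prop :=
  forall (J : {set 'I_n}) (B : 'I_n -> set R), (forall i, measurable (B i)) ->
    P (\bigcap_(i in [set` J]) X i @^-1` B i)
    = (\prod_(i in J) P (X i @^-1` B i))%E.

Definition sub_measurable (G : set (set Omega)) (f : Omega -> R) : Prop :=
  preimage_set_system setT f measurable `<=` G.

Definition independent_of (G : set (set Omega)) (X : {RV P >-> R}) : Prop :=
  forall (A : set Omega) (B : set R), G A -> measurable B ->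
    P (A `&` X @^-1` B) = (P A * P (X @^-1` B))%E.

Definition filtration (N : nat) (F : nat -> set (set Omega)) : Prop :=
  (forall j, (j <= N)%N -> sigma_algebra setT (F j) /\ F j `<=` measurable) /\
  (forall j k, (j <= k)%N -> (k <= N)%N -> F j `<=` F k).

Definition predictable_gaussian_sums (N : nat) (T : finType)
    (F : nat -> set (set Omega)) (g : 'I_N -> {RV P >-> R})
    (A : T -> 'I_N -> Omega -> R) : Prop :=
  [/\ filtration N F,
      forall i, std_gaussian (g i),
      forall i : 'I_N, independent_of (F i) (g i),
      forall i : 'I_N, sub_measurable (F i.+1) (g i) &
      forall (t : T) (i : 'I_N), sub_measurable (F i) (A t i)].

End Probability.

Section Example.
Context {R : realType} {n : nat}.

(* {-1,1}^n is {ffun 'I_n -> bool}, with coordinates read through signT. *)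
Definition signT (theta : {ffun 'I_n -> bool}) (i : 'I_n) : R :=
  (-1) ^+ theta i.

Definition coefT (g : 'I_n -> R) (theta : {ffun 'I_n -> bool}) (i : 'I_n) : R :=
  signT theta i
  * \prod_(k < n | (k < i)%N) (signT theta k == Num.sg (g k))%:R.

End Example.

(* Main.v *)
Require Import Defs.
From HB Require Import structures.
From mathcomp Require Import all_boot all_order all_algebra.
From mathcomp Require Import all_classical all_reals all_analysis.
From mathcomp Require Import measurable_realfun ring lra zify.

Set Implicit Arguments.
Unset Strict Implicit.
Unset Printing Implicit Defensive.

Import Order.TTheory GRing.Theory Num.Theory.
Import numFieldNormedType.Exports.

Local Open Scope classical_set_scope.
Local Open Scope ring_scope.

(** Up to a null event, [a^theta] depends only on the first index at which
   [theta] disagrees with the signs [b] of the Gaussians, so [(T, d)] collapses to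
   [n + 1] leaves [s = 0, ..., n] with [d(s, s')^2 <= 4 + |s - s'|].  Hence the
   uniform measure on the leaves gives the ball of radius [r] mass at least of
   order [(1 + r)^2 / n], and since [ln (e y^2) <= 2 y] the entropy integral is at
   most of order [n^(1/4) int_0^sqrt(n + 4) (1 + r)^(-1/2) dr], that is [sqrt n].
   On the other hand [theta = b] collects [sum_i |gamma_i|], whose expectation is
   [sqrt (2 / pi) n]. *)

(** * Combinatorics of the stopped sign paths *)

Section Core.
Context {R : realType} {n : nat}.
Implicit Types (b t : {ffun 'I_n -> bool}) (i k : 'I_n).

(** The sign pattern is a free Boolean vector here, which excludes the value 0 of the sign and makes
    the metric a function of finite data. *)
Definition coefB b t i : R :=
  signT t i * \prod_(k < n | (k < i)%N) (t k == b k)%:R.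

(** Representative of leaf [s]. Since [n] is not a valid index, [flip b n] is [b] itself, the leaf
    without disagreement. *)
Definition flip b (s : nat) : {ffun 'I_n -> bool} :=
  [ffun k => b k (+) (k == s :> nat)].

Lemma coefB_agree b t i : (forall k, (k < i)%N -> t k = b k) ->
  coefB b t i = signT t i.
Proof.
by move=> h; rewrite /coefB big1 ?mulr1// => k /h ->; rewrite eqxx.
Qed.

Lemma coefB_disagree b t i k : (k < i)%N -> t k != b k -> coefB b t i = 0.
Proof.
by move=> ki /negbTE tb; rewrite /coefB (bigD1 k)//= tb mul0r mulr0.
Qed.

Lemma coefB_flip b (s : nat) i : coefB b (flip b s) i =
  if (i < s)%N then signT b i else if (i == s :> nat) then - signT b i else 0.
Proof.
have [is_|si|e] := ltngtP i s.
- rewrite coefB_agree => [|k ki]; rewrite ?/signT ffunE.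
    by rewrite ltn_eqF// addbF.
  by rewrite ltn_eqF ?(ltn_trans ki)// addbF.
- have sn : (s < n)%N by apply: ltn_trans (ltn_ord i).
  by rewrite (@coefB_disagree _ _ _ (Ordinal sn))//= ffunE/= eqxx addbT; case: (b _).
- rewrite coefB_agree => [|k ki]; rewrite ?/signT ffunE.
    by rewrite e eqxx addbT signrN.
  by rewrite ltn_eqF -?e// addbF.
Qed.

(* The flip index is the first disagreement of [t] with [b], or [n] if none. *)
Lemma coefB_eq_flip b t :
  exists s : 'I_n.+1, forall i, coefB b t i = coefB b (flip b s) i.
Proof.
have [[i0 tb0]|/forallNP tb] := pselect (exists i, t i != b i); last first.
  exists ord_max => i; rewrite coefB_flip /= ltn_ord coefB_agree => [|k _].
    by rewrite /signT (eqP (negbNE (introN idP (tb i)))).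
  exact/eqP/negbNE/negP/tb.
case: (arg_minnP (P := fun i => t i != b i) (fun i => i : nat) tb0) => s ts smin.
have agree k : (k < s)%N -> t k = b k.
  by move=> ks; apply: contraTeq ks => /smin; rewrite leqNgt.
exists (widen_ord (leqnSn n) s) => i; rewrite coefB_flip /=.
have [is_|si|/val_inj ->] := ltngtP i s.
- rewrite coefB_agree ?/signT ?agree// => k ki.
  by apply: agree; apply: ltn_trans is_.
- exact: coefB_disagree ts.
- rewrite coefB_agree// /signT -signrN; congr ((-1) ^+ nat_of_bool _).
  by move: ts; case: (t s); case: (b s).
Qed.

(** Before [s] the coefficients agree. If [s < s'], they are opposite signs at [s], which costs 4;
    at the indices in [(s, s']] the first vanishes and the second has modulus 1; after [s'] both
    vanish. *)
Lemma flip_dist b (s s' : 'I_n.+1) : (s <= s')%N ->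
  \sum_(i < n) `|coefB b (flip b s) i - coefB b (flip b s') i| ^+ 2
  <= 4 + (s' - s)%:R.
Proof.
move=> ss'.
have sg1 i : `|signT b i : R| = 1 by rewrite /signT normrX normrN1 expr1n.
apply: (@le_trans _ _ (\sum_(i < n) (4 * (i == s :> nat)%:R
     + ((s < i)%N && (i <= s')%N)%:R))).
  apply: ler_sum => i _; rewrite !coefB_flip.
  have [is_|si|e] := ltngtP i s.
  - by rewrite (leq_trans is_ ss') subrr normr0 expr0n/= mulr0 addr0.
  - have [is'|si'|e'] := ltngtP i s' => /=.
    + by rewrite sub0r normrN sg1 expr1n; lra.
    + by rewrite subrr normr0 expr0n/= mulr0 addr0.
    + by rewrite sub0r opprK sg1 expr1n; lra.
  - have [is'|si'|e'] := ltngtP i s' => /=.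
    + rewrite -opprD normrN -mulr2n normrMn sg1; lra.
    + by move: si'; rewrite e ltnNge ss'.
    + by rewrite subrr normr0 expr0n/=; lra.
rewrite big_split/= -mulr_sumr; apply: lerD.
  rewrite ler_piMr// -natr_sum (_ : 1 = 1%:R)// ler_nat.
  have [sn|ns] := ltnP s n.
    rewrite (bigD1 (Ordinal sn))//= eqxx big1// => i.
    by rewrite -val_eqE/= => /negbTE ->.
  by rewrite big1// => i _; rewrite ltn_eqF// (leq_trans _ ns).
rewrite -natr_sum ler_nat.
rewrite -(big_mkord xpredT (fun i : nat => ((s < i)%N && (i <= s')%N : nat))).
(* One extra index is added because the cut point [s'.+1] can be [n.+1]. *)
apply: (@leq_trans (\sum_(0 <= i < n.+1) ((s < i)%N && (i <= s')%N))).
  by rewrite big_nat_recr//= leq_addr.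
rewrite (big_cat_nat (n := s'.+1))//=.
rewrite [X in (_ + X)%N]big_nat [X in (_ + X)%N]big1 ?addn0 => [|i]; last first.
  by case/andP => si _; rewrite (leqNgt i) si andbF.
rewrite (big_cat_nat (n := s.+1))//= ?ltnS//.
rewrite big_nat big1 ?add0n => [|i]; last first.
  by case/andP => _; rewrite ltnS leqNgt => /negbTE ->.
apply: (@leq_trans (\sum_(s.+1 <= i < s'.+1) 1)).
  by apply: leq_sum => i _; exact: leq_b1.
by rewrite sum_nat_const_nat muln1 subSS.
Qed.

(** The two truncated differences together encode [|s - s'| <= k]. *)
Lemma sqdist_flip b (s s' : 'I_n.+1) (k : nat) :
  (s - s' <= k)%N -> (s' - s <= k)%N ->
  sqdist (coefB b) (flip b s) (flip b s') <= Num.sqrt (4 + k%:R).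
Proof.
move=> k1 k2; apply: ler_wsqrtr.
wlog ss' : s s' k1 k2 / (s <= s')%N => [hw|].
  have [/hw|/ltnW s's] := leqP s s'; first exact.
  under eq_bigr do rewrite distrC.
  exact: hw.
by apply: le_trans (flip_dist b ss') _; rewrite lerD2l ler_nat.
Qed.

Lemma sqdist_congr b t t' u : (forall i, coefB b t i = coefB b t' i) ->
  sqdist (coefB b) t u = sqdist (coefB b) t' u.
Proof. by move=> e; rewrite /sqdist; under eq_bigr do rewrite e. Qed.

Lemma sqdistC N (T : finType) (a : T -> 'I_N -> R) (t u : T) : sqdist a t u = sqdist a u t.
Proof. by rewrite /sqdist; under eq_bigr do rewrite distrC. Qed.

Lemma sqdist_coefB_le b t u : sqdist (coefB b) t u <= Num.sqrt (4 + n%:R).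
Proof.
have [s ts] := coefB_eq_flip b t; have [s' us'] := coefB_eq_flip b u.
rewrite (sqdist_congr _ ts) sqdistC (sqdist_congr _ us').
by apply: sqdist_flip; apply: leq_trans (leq_subr _ _) _; rewrite -ltnS.
Qed.

Lemma diam_coefB_le b : diam (sqdist (coefB b)) <= Num.sqrt (4 + n%:R).
Proof.
by apply: bigmax_le => [|t _]; rewrite ?sqrtr_ge0//;
  apply: bigmax_le => [|u _]; rewrite ?sqrtr_ge0//; exact: sqdist_coefB_le.
Qed.

(** Half of the mass is uniform over the [n + 1] leaf representatives; the other half is uniform on
    the whole cube and secures full support. *)
Definition leaf_measure b t : R :=
  2^-1 * n.+1%:R^-1 * (\sum_(s < n.+1) (flip b s == t)%:R)
  + 2^-1 * #|{ffun 'I_n -> bool}|%:R^-1.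

Lemma leaf_measure_full_support b : full_support_prob (leaf_measure b).
Proof.
have card0 : (0 < #|{ffun 'I_n -> bool}|)%N by apply/card_gt0P; exists b.
split=> [t|].
  rewrite ltr_wpDl// ?mulr_ge0 ?invr_ge0 ?sumr_ge0//.
  by rewrite mulr_gt0 ?invr_gt0 ?ltr0n.
rewrite /leaf_measure big_split/= -mulr_sumr exchange_big/= sumr_const.
rewrite (eq_bigr (fun=> 1)) => [|s _]; last first.
  rewrite (bigD1 (flip b s))//= eqxx big1 ?addr0// => t.
  by rewrite eq_sym => /negbTE ->.
rewrite sumr_const card_ord -!mulrA mulVf ?pnatr_eq0// mulr1.
rewrite -mulrnAr -[_^-1 *+ _]mulr_natr mulVf ?pnatr_eq0 -?lt0n//; lra.
Qed.

Lemma ball_mass_leaf_ge b t (r : R) :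
  2^-1 * n.+1%:R^-1 * (\sum_(s < n.+1) (sqdist (coefB b) t (flip b s) <= r)%R%:R)
  <= ball_mass (leaf_measure b) (sqdist (coefB b)) t r.
Proof.
rewrite /ball_mass /leaf_measure big_split/=.
apply: (@le_trans _ _ (2^-1 * n.+1%:R^-1 * \sum_(s < n.+1)
   \sum_(u | sqdist (coefB b) t u <= r) (flip b s == u)%:R)).
  rewrite ler_wpM2l ?mulr_ge0 ?invr_ge0//; apply: ler_sum => s _.
  have [dr|_] := boolP (_ <= r); last by rewrite sumr_ge0.
  rewrite (bigD1 (flip b s))//= eqxx lerDl.
  by apply: sumr_ge0.
rewrite exchange_big/= mulr_sumr lerDl.
by apply: sumr_ge0 => u _; rewrite mulr_ge0 ?invr_ge0.
Qed.

(** For large [r] the ball contains every leaf within [L = floor (r^2 - 4)] of the leaf of [t]. As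
    [L <= n], at least [L + 1] of these lie in [[0, n]], even when the leaf is near an end. For
    small [r] the leaf of [t] alone suffices. *)
Lemma leaf_count_ge b t (r : R) : 0 <= r -> r ^+ 2 <= 4 + n%:R ->
  (1 + r) ^+ 2 / 20
  <= \sum_(s < n.+1) (sqdist (coefB b) t (flip b s) <= r)%R%:R.
Proof.
move=> r0 rn; have [s ts] := coefB_eq_flip b t.
have [r5|r5] := leP (r ^+ 2) 5.
  (* Here [(1 + r)^2 <= 2 (1 + r^2) <= 12]. *)
  apply: (@le_trans _ _ 1); first by nra.
  have dts : sqdist (coefB b) t (flip b s) = 0.
    rewrite (sqdist_congr _ ts) /sqdist big1 ?sqrtr0// => i _.
    by rewrite subrr normr0 expr0n.
  rewrite (bigD1 s)//= dts r0 lerDl.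
  by apply: sumr_ge0.
have r40 : 0 <= r ^+ 2 - 4 by lra.
pose L := Num.truncn (r ^+ 2 - 4).
have /andP[L1 L2] : L%:R <= r ^+ 2 - 4 < L.+1%:R by rewrite /L; exact: truncn_itv.
have Ln : (L <= n)%N by rewrite -(ler_nat R); lra.
(* For [r^2 > 5], [(1 + r)^2 <= 2 (1 + r^2) <= 20 (r^2 - 4)]. *)
apply: (@le_trans _ _ L.+1%:R); first by nra.
(* [lo, lo + L] is an integer interval containing s inside [0, n] *)
pose lo := minn s (n - L).
have sn : (s <= n)%N by rewrite -ltnS.
rewrite -natr_sum ler_nat.
have -> : L.+1 = (\sum_(lo <= i < lo + L.+1) 1)%N.
  by rewrite sum_nat_const_nat muln1 addnC addnK.
rewrite -(big_mkord xpredT (fun i : nat => nat_of_bool (sqdist (coefB b) t (flip b i) <= r)%R)).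
have lon : (lo + L.+1 <= n.+1)%N by rewrite /lo; lia.
have lo1 : (lo <= n.+1)%N by apply: leq_trans lon; rewrite leq_addr.
rewrite [leqRHS](big_cat_nat (n := lo))//=.
rewrite [X in (_ <= _ + X)%N](big_cat_nat (n := lo + L.+1))//= ?leq_addr//.
rewrite addnCA; apply: leq_trans (leq_addr _ _).
rewrite big_nat [leqRHS]big_nat; apply: leq_sum => i /andP[loi iL].
rewrite (sqdist_congr _ ts).
have in_ : (i < n.+1)%N by apply: leq_trans lon.
suff -> : sqdist (coefB b) (flip b s) (flip b (Ordinal in_)) <= r by [].
apply: le_trans (@sqdist_flip b s (Ordinal in_) L _ _) _ => /=.
- by move: loi iL; rewrite /lo; lia.
- by move: loi iL; rewrite /lo; lia.
- by rewrite -[leRHS](ger0_norm r0) -sqrtr_sqr ler_wsqrtr//; lra.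
Qed.

End Core.

(** * Monotonicity of the integral for arbitrary nonnegative functions *)

Section Integral.
Import HBNNSimple.
Context d (T : measurableType d) (R : realType).
Variable mu : {measure set T -> \bar R}.

(* Unlike [ge0_le_integral], no measurability is required: the integral of a
   nonnegative function is the supremum over the simple functions below it. *)
Lemma ge0_le_integral_gen (D : set T) (f g : T -> \bar R) :
  (forall x, D x -> 0 <= f x)%E -> (forall x, D x -> f x <= g x)%E ->
  (\int[mu]_(x in D) f x <= \int[mu]_(x in D) g x)%E.
Proof.
move=> f0 fg.
have g0 x : D x -> (0 <= g x)%E by move=> Dx; apply: le_trans (f0 _ Dx) (fg _ Dx).
rewrite ge0_integralE// ge0_integralE//.
apply: ereal_sup_le => _ [h hf <-]; exists h => // x.
apply: le_trans (hf x) _; rewrite /patch; case: ifPn => //.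
by rewrite inE => /fg.
Qed.

End Integral.

(** * Absolute first moment and absence of atoms of the standard Gaussian *)

Section Gaussian.
Context {R : realType}.

(** Change of variables through the Radon-Nikodym derivative, which equals [normal_pdf] almost
    everywhere because both have the same integral over each measurable set. *)
Lemma ge0_integral_normal_prob (f : R -> R) :
  measurable_fun [set: R] f -> (forall x, 0 <= f x) ->
  (\int[@normal_prob R 0 1]_x (f x)%:E
   = \int[lebesgue_measure]_x (f x * normal_pdf 0 1 x)%:E)%E.
Proof.
move=> mf f0.
pose nm := @normal_prob R 0 1.
have dom : nm `<< lebesgue_measure by exact: normal_prob_dominates.
under [RHS]eq_integral do rewrite EFinM.
have mf' : measurable_fun [set: R] (fun x => (f x)%:E) by exact/measurable_EFinP.
rewrite -(Radon_Nikodym_SigmaFinite.change_of_variables dom)//.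
have mp : measurable_fun [set: R] (fun x => (@normal_pdf R 0 1 x)%:E).
  by apply/measurable_EFinP; exact: measurable_normal_pdf.
have mrn := measurable_int _ (Radon_Nikodym_SigmaFinite.f_integrable dom).
apply: ge0_ae_eq_integral => //.
- exact: emeasurable_funM.
- exact: emeasurable_funM.
- by move=> x _; rewrite mule_ge0 ?lee_fin ?Radon_Nikodym_SigmaFinite.f_ge0.
- by move=> x _; rewrite -EFinM lee_fin mulr_ge0 ?normal_pdf_ge0.
apply: ae_eqe_mul2l; apply: integral_ae_eq => //.
  exact: Radon_Nikodym_SigmaFinite.f_integrable.
by move=> E _ mE; rewrite -Radon_Nikodym_SigmaFinite.f_integral.
Qed.

Let pdfE (x : R) : normal_pdf 0 1 x = normal_peak 1 * expR (- x ^+ 2 / 2).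
Proof.
by rewrite normal_pdfE ?oner_neq0// /normal_pdf /normal_fun subr0 expr1n.
Qed.

Let is_derive_pdf (x : R) :
  is_derive x 1 (fun y => - normal_pdf 0 1 y) (x * normal_pdf 0 1 x).
Proof.
have -> : (fun y : R => - normal_pdf 0 1 y)
   = (- normal_peak 1 : R) *: (expR \o (fun y : R => - 2^-1 *: (y ^+ 2))).
  apply/funext => y; rewrite pdfE.
  rewrite -[RHS]/(- normal_peak 1 * expR (- 2^-1 * y ^+ 2)).
  by rewrite [RHS]mulNr (_ : - 2^-1 * y ^+ 2 = - y ^+ 2 / 2)//; field.
rewrite pdfE.
apply: is_derive_eq.
change (- normal_peak 1 * (expR (- 2^-1 * x ^+ 2) * (- 2^-1 * (x * 1 + x * 1)))
  = x * (normal_peak 1 * expR (- x ^+ 2 / 2))).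
have -> : - 2^-1 * x ^+ 2 = - x ^+ 2 / 2 by field.
by field.
Qed.

Let cvg_pdf : - normal_pdf 0 1 x @[x --> +oo] --> (0 : R).
Proof.
rewrite -[X in _ --> X]oppr0; apply: (@cvgN _ R^o).
rewrite (funext pdfE).
rewrite -(mulr0 (normal_peak 1)); apply: cvgM; first exact: cvg_cst.
have -> : (fun x : R => expR (- x ^+ 2 / 2))
    = (fun x => expR (- x)) \o (fun x : R => x ^+ 2 / 2).
  by apply/funext => x /=; rewrite mulNr.
apply: cvg_comp; last exact: cvgr_expR.
by apply: gt0_cvgMly => //; exact: cvgr_expr2.
Qed.

(** By symmetry this is twice the integral of [x * normal_pdf 0 1 x] over the half line; the
    primitive [- normal_pdf 0 1] gives [2 / sqrt (2 pi)]. *)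
Lemma integral_abs_normal_prob :
  (\int[@normal_prob R 0 1]_x (`|x|)%:E = (Num.sqrt (2 / pi))%:E)%E.
Proof.
have cpdf : continuous (@normal_pdf R 0 1).
  by apply: continuous_normal_pdf; exact: oner_neq0.
have cf : continuous (fun x : R => `|x| * normal_pdf 0 1 x).
  by move=> x; apply: cvgM; [exact: norm_continuous|exact: cpdf].
rewrite (ge0_integral_normal_prob (@normr_measurable R setT))//.
rewrite ge0_symfun_integralT//=; last first.
- by move=> x/=; rewrite normrN !pdfE sqrrN.
- by move=> x; rewrite mulr_ge0// normal_pdf_ge0.
have -> : [set x : R | 0 <= x] = `[0, +oo[%classic.
  by rewrite set_itvcy.
rewrite (@ge0_continuous_FTC2y R _ (fun x => - normal_pdf 0 1 x) 0 0)//.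
- rewrite sub0e EFinN oppeK -EFinM; congr EFin.
  rewrite pdfE expr0n/= oppr0 mul0r expR0 mulr1 /normal_peak expr1n mul1r.
  have -> : pi *+ 2 = 2 * pi :> R by rewrite mulr_natl.
  rewrite (sqrtrM pi)// (sqrtrM pi^-1)// sqrtrV ?pi_ge0//.
  have s2 : Num.sqrt 2 != 0 :> R by rewrite sqrtr_eq0 -ltNge.
  have sp : Num.sqrt pi != 0 :> R by rewrite sqrtr_eq0 -ltNge pi_gt0.
  have e2 : 2 = Num.sqrt 2 ^+ 2 :> R by rewrite sqr_sqrtr.
  rewrite {1}e2; field.
  by rewrite sp s2.
- by move=> x _; rewrite mulr_ge0// normal_pdf_ge0.
- exact: continuous_subspaceT.
- by move=> x x0; have [] := is_derive_pdf x.
- by apply: cvg_at_right_filter; apply: (@cvgN _ R^o); exact: cpdf.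
- move=> x; rewrite in_itv/= andbT => x0.
  rewrite derive1E gtr0_norm//.
  by rewrite (@derive_val _ _ _ _ _ _ _ (is_derive_pdf x)).
Qed.

(* [measurableTypeR R], on which [normal_prob] lives, and [R] carry the same
   sigma-algebra but distinct measurable structures. *)
Definition toR : measurableTypeR R -> R := id.

Lemma measurable_toR : measurable_fun setT toR.
Proof. by move=> _ B mB; rewrite setTI. Qed.

HB.instance Definition _ := isMeasurableFun.Build _ _ _ _ toR measurable_toR.

Definition standard_normal : probability (measurableTypeR R) R :=
  @normal_prob R 0 1.

Lemma expectation_abs_gaussian d (Omega : measurableType d)
    (P : probability Omega R) (X : {RV P >-> R}) :
  std_gaussian X -> (\int[P]_w (`|X w|)%:E = (Num.sqrt (2 / pi))%:E)%E.
Proof.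
move=> gX; rewrite -integral_abs_normal_prob.
have mabs : measurable_fun [set: R] (fun x : R => (`|x|)%:E).
  by apply/measurable_EFinP; exact: normr_measurable.
rewrite -(@ge0_integral_distribution _ _ _ _ _ _ X (fun x => (`|x|)%:E))//.
rewrite -[RHS](@ge0_integral_distribution _ _ _ _ _ standard_normal
  (toR : {RV standard_normal >-> R}) (fun x => (`|x|)%:E))//.
by apply: eq_measure_integral => A mA _; exact: gX.
Qed.

(** Makes vanishing signs a null event, so that [coefT] can be replaced by [coefB] almost surely. *)
Lemma gaussian_neq0 d (Omega : measurableType d)
    (P : probability Omega R) (X : {RV P >-> R}) :
  std_gaussian X -> P (X @^-1` [set 0]) = 0%E.
Proof.
move=> /(_ [set 0] (measurable_set1 _)) => e.
rewrite (_ : P _ = distribution P X [set 0])// e.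
have := @normal_prob_dominates R 0 1.
by move/null_content_dominatesP; apply => //; exact: lebesgue_measure_set1.
Qed.

End Gaussian.

(** * Entropy integral under a quadratic lower bound on ball masses *)

Section Gamma.
Context {R : realType}.

Let continuous_inv_sqrt (K b : R) :
  {within `[0, b], continuous (fun r : R => K / Num.sqrt (1 + r))}.
Proof.
apply: continuous_in_subspaceT => x; rewrite inE/= in_itv/= => /andP[x0 _].
apply: cvgM; first exact: cvg_cst.
apply: cvgV; first by rewrite gt_eqF// sqrtr_gt0; lra.
apply: (cvg_comp (fun x => 1 + x) (@Num.sqrt R)); last exact: sqrt_continuous.
by apply: (@cvgD _ R^o); [exact: cvg_cst|exact: cvg_id].
Qed.

Lemma integral_inv_sqrt (K b : R) : 0 < b ->
  (\int[lebesgue_measure]_(r in `[0%R, b]) (K / Num.sqrt (1 + r))%:E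
   = (2 * K * (Num.sqrt (1 + b) - 1))%:E)%E.
Proof.
move=> b0.
pose F : R -> R := (2 * K) *: (@Num.sqrt R \o (fun x => 1 + x)).
(* Differentiability down to -1 makes both endpoints of [[0, b]] interior points. *)
have dF (x : R) : -1 < x -> is_derive x 1 F (K / Num.sqrt (1 + x)).
  move=> x0.
  have x1 : 0 < 1 + x by lra.
  have s0 : Num.sqrt (1 + x) != 0 by rewrite gt_eqF// sqrtr_gt0.
  have ds := is_derive1_sqrt x1.
  apply: is_derive_eq.
  change (2 * K * ((2 * Num.sqrt (1 + x))^-1 * ((0 + 1) * 1)) = K / Num.sqrt (1 + x)).
  by field.
have cF (x : R) : -1 < x -> F y @[y --> x] --> F x.
  by move=> x0; apply/differentiable_continuous/derivable1_diffP; have [] := dF x x0.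
rewrite (@continuous_FTC2 R _ F)//.
- rewrite -EFinB; congr EFin.
  change (2 * K * Num.sqrt (1 + b) - 2 * K * Num.sqrt (1 + 0)
    = 2 * K * (Num.sqrt (1 + b) - 1)).
  by rewrite addr0 sqrtr1; ring.
- split.
  + move=> x; rewrite in_itv/= => /andP[x0 _].
    have x1 : -1 < x by lra.
    by have [] := dF x x1.
  + by apply: cvg_at_right_filter; apply: cF; lra.
  + by apply: cvg_at_left_filter; apply: cF; lra.
- move=> x; rewrite in_itv/= => /andP[x0 _].
  have x1 : -1 < x by lra.
  by rewrite derive1E (@derive_val _ _ _ _ _ _ _ (dF x x1)).
Qed.

(** With [y = Q / (1 + r)] the mass is at least [y^-2], so the logarithm is at most
    [ln (e y^2) <= 2 y] and the integrand at most [sqrt (2 Q) / sqrt (1 + r)], which has an explicit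
    primitive. *)
Lemma GammaF_le (T : finType) (m : T -> R) (d : T -> T -> R) (D Q : R) :
  0 < D -> 0 < Q -> diam d <= D ->
  (forall t r, 0 <= r -> r <= D -> (1 + r) ^+ 2 / Q ^+ 2 <= ball_mass m d t r) ->
  (GammaF m d <= (2 * Num.sqrt (2 * Q) * Num.sqrt (1 + D))%:E)%E.
Proof.
move=> D0 Q0 dD massge; apply: ub_ereal_sup => _ [t _ <-].
pose K := Num.sqrt (2 * Q).
have sub : `[0%R, diam d] `<=` `[0%R, D].
  by move=> r /=; rewrite !in_itv/= => /andP[-> /le_trans->].
apply: (@le_trans _ _ (\int[lebesgue_measure]_(r in `[0%R, diam d])
    (K / Num.sqrt (1 + r))%:E)%E).
  apply: ge0_le_integral_gen => r.
    by rewrite lee_fin sqrtr_ge0.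
  move=> /sub/=; rewrite in_itv/= => /andP[r0 rD]; rewrite lee_fin.
  have r1 : 0 < 1 + r by lra.
  have s0 : 0 < Num.sqrt (1 + r) by rewrite sqrtr_gt0.
  have mass := massge t r r0 rD.
  have q0 : 0 < Q / (1 + r) by rewrite divr_gt0.
  have m0 : 0 < ball_mass m d t r.
    by apply: lt_le_trans mass; rewrite divr_gt0// exprn_gt0.
  rewrite /K -sqrtrV; last exact: ltW.
  rewrite -sqrtrM; last by lra.
  rewrite ler_wsqrtr//.
  have mV : (ball_mass m d t r)^-1 <= (Q / (1 + r)) ^+ 2.
    have -> : (Q / (1 + r)) ^+ 2 = ((1 + r) ^+ 2 / Q ^+ 2)^-1.
      by rewrite invfM invrK expr_div_n mulrC.
    by rewrite lef_pV2// posrE divr_gt0// exprn_gt0.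
  apply: (@le_trans _ _ (ln (expR 1 * (Q / (1 + r)) ^+ 2))).
    rewrite ler_ln ?posrE ?divr_gt0 ?expR_gt0//.
      by rewrite ler_wpM2l ?expR_ge0.
    by rewrite mulr_gt0 ?expR_gt0 ?exprn_gt0.
  (* [1 + 2 ln y <= 2 y - 1], from [ln y <= y - 1]. *)
  rewrite lnM ?posrE ?expR_gt0 ?exprn_gt0// expRK lnXn// -mulr_natl.
  have y1 : -1 < Q / (1 + r) - 1 by lra.
  by have := le_ln1Dx y1; rewrite addrC subrK -mulrA; lra.
apply: (@le_trans _ _ (\int[lebesgue_measure]_(r in `[0%R, D])
    (K / Num.sqrt (1 + r))%:E)%E).
  apply: ge0_subset_integral => //.
    apply/measurable_EFinP; apply: subspace_continuous_measurable_fun => //.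
    exact: continuous_inv_sqrt.
  by move=> r _; rewrite lee_fin mulr_ge0 ?invr_ge0 ?sqrtr_ge0.
rewrite integral_inv_sqrt// lee_fin ler_wpM2l ?mulr_ge0 ?sqrtr_ge0//.
by rewrite gerBl.
Qed.

End Gamma.

(** * Existence of filtered Gaussian sequences of any length *)

Section Construction.
Context {R : realType}.

Definition mkRV d (Omega : measurableType d) (P : probability Omega R)
    (f : Omega -> R) (mf : measurable_fun setT f) : {RV P >-> R} :=
  HB.pack_for {mfun Omega >-> R} f (isMeasurableFun.Build _ _ _ _ f mf).

(** The variables are indexed by [nat] and constrained only below [N], so the index type stays fixed
    in the induction on [N]. *)
Definition gaussian_model (N : nat) d (Omega : measurableType d)
    (P : probability Omega R) (F : nat -> set (set Omega))
    (g : nat -> {RV P >-> R}) : Prop :=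
  filtration N F /\
  forall i, (i < N)%N -> [/\ std_gaussian (g i), independent_of (F i) (g i)
    & sub_measurable (F i.+1) (g i)].

Section Extend.
Context d (Omega : measurableType d) (P : probability Omega R).

Let Omega' := (Omega * measurableTypeR R)%type.

Definition extend_prob : probability Omega' R := (P \x standard_normal)%E.

Lemma extend_probE (A : set Omega) (B : set R) :
  measurable A -> measurable B ->
  extend_prob (fst @^-1` A `&` (toR \o snd) @^-1` B)
  = (P A * normal_prob 0 1 B)%E.
Proof.
move=> mA mB; rewrite (_ : _ `&` _ = A `*` B)//.
exact: product_measure1E.
Qed.

Lemma extend_prob_fst (A : set Omega) : measurable A ->
  extend_prob (fst @^-1` A) = P A.
Proof.
move=> mA; rewrite -[X in extend_prob X]setIT -(preimage_setT (toR \o snd)).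
rewrite extend_probE// (_ : normal_prob 0 1 setT = 1%E) ?mule1//.
exact: (probability_setT standard_normal).
Qed.

Lemma extend_prob_snd (B : set R) : measurable B ->
  extend_prob ((toR \o snd) @^-1` B) = normal_prob 0 1 B.
Proof.
move=> mB; rewrite -[X in extend_prob X]setTI -(preimage_setT fst).
by rewrite extend_probE// probability_setT mul1e.
Qed.

Lemma measurable_comp_fst (X : {RV P >-> R}) :
  measurable_fun [set: Omega'] (X \o fst).
Proof. by apply: measurableT_comp => //; exact: measurable_fst. Qed.

Lemma measurable_toR_snd : measurable_fun [set: Omega'] (toR \o snd).
Proof. by apply: measurableT_comp => //; exact: measurable_snd. Qed.

Definition extend_rv (N : nat) (g : nat -> {RV P >-> R}) (i : nat)
    : {RV extend_prob >-> R} :=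
  if (i < N)%N then mkRV extend_prob (measurable_comp_fst (g i))
  else mkRV extend_prob measurable_toR_snd.

(** Up to time [N] the events are cylinders over the old space, hence independent of the new
    coordinate; time [N + 1] reveals everything. *)
Definition extend_filtration (N : nat) (F : nat -> set (set Omega)) (j : nat)
    : set (set Omega') :=
  if (j <= N)%N then preimage_set_system setT fst (F j) else measurable.

(** The new variable is independent of time [N] by the product formula; for the old ones all events
    are cylinders, whose probabilities are those under [P]. *)
Lemma gaussian_model_extend N F g : gaussian_model N F g ->
  gaussian_model N.+1 (extend_filtration N F) (extend_rv N g).
Proof.
move=> [[Fsig Fle] gF].
have Fm j A : (j <= N)%N -> F j A -> measurable A by move=> jN; exact: (Fsig j jN).2.
have F'm j : extend_filtration N F j `<=` measurable.
  rewrite /extend_filtration; case: ifPn => [jN X [A FA <-]|_ X //].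
  by rewrite setTI -[X in measurable X]setTI; apply: measurable_fst => //; exact: Fm jN FA.
split; first split.
- move=> j jN; split => //.
  rewrite /extend_filtration; case: ifPn => [jN'|_].
    by apply: sigma_algebra_preimage; exact: (Fsig j jN').1.
  exact: sigma_algebra_measurable.
- move=> j k jk kN; have [kN'|kN'] := leqP k N.
    rewrite /extend_filtration kN' (leq_trans jk kN') => X [A FA <-].
    by exists A => //; exact: Fle FA.
  by rewrite {2}/extend_filtration leqNgt kN'; exact: F'm.
- move=> i; rewrite ltnS leq_eqVlt => /predU1P[->|iN].
    rewrite /extend_rv ltnn; split.
    + by move=> B mB; exact: extend_prob_snd.
    + move=> A' B + mB; rewrite /extend_filtration leqnn => -[A FA <-].
      rewrite setTI.
      have mA : measurable A by apply: (Fm N).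
      by rewrite extend_probE// extend_prob_fst// extend_prob_snd.
    + move=> _ [B mB <-]; rewrite /extend_filtration ltnn.
      exact: measurable_toR_snd.
  have [gg gi gm] := gF i iN.
  have mg B : measurable B -> measurable (g i @^-1` B).
    by move=> mB; rewrite -[X in measurable X]setTI; exact: measurable_funPT.
  rewrite /extend_rv iN; split.
  + move=> B mB; rewrite -gg//.
    by rewrite -[RHS]extend_prob_fst//; exact: mg.
  + move=> A' B + mB; rewrite /extend_filtration ltnW// => -[A FA <-].
    have mA : measurable A by apply: (Fm i) => //; exact: ltnW.
    rewrite setTI [LHS](_ : _ = extend_prob (fst @^-1` (A `&` g i @^-1` B)))//.
    rewrite !extend_prob_fst ?gi//; last by apply: measurableI => //; exact: mg.
    congr *%E; rewrite -extend_prob_fst//; exact: mg.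
  + move=> _ [B mB <-]; rewrite /extend_filtration iN setTI.
    exists (g i @^-1` B); last by rewrite setTI.
    by apply: gm; exists B => //; rewrite setTI.
Qed.

End Extend.

(** Refuting a universal constant requires an actual probability space for every length; each step
    adjoins one Gaussian coordinate. *)
Lemma gaussian_model_exists (N : nat) :
  exists (d : measure_display) (Omega : measurableType d)
    (P : probability Omega R) (F : nat -> set (set Omega))
    (g : nat -> {RV P >-> R}), gaussian_model N F g.
Proof.
elim: N => [|N IH].
  exists _, (measurableTypeR R), standard_normal, (fun=> measurable), (fun=> toR).
  split=> //; split=> [j _|j k jk k0 X //].
  by split=> //; exact: sigma_algebra_measurable.
case: IH => d; case=> Omega; case=> P; case=> F; case=> g model.
exists _, _, (extend_prob P), (extend_filtration N F), (extend_rv N g).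
exact: gaussian_model_extend.
Qed.

End Construction.

(** * Comparison of integrals outside a null set *)

Section AeIntegral.
Context d (T : measurableType d) (R : realType).
Variable mu : {measure set T -> \bar R}.

(** Measurability of [f] allows the null set to be removed on the left; on the right the removal
    only shrinks the domain, so [g] may be arbitrary. *)
Lemma ae_ge0_le_integral_gen (f g : T -> \bar R) :
  measurable_fun setT f -> (forall x, 0 <= f x)%E -> (forall x, 0 <= g x)%E ->
  {ae mu, forall x, (f x <= g x)%E} ->
  (\int[mu]_x f x <= \int[mu]_x g x)%E.
Proof.
move=> mf f0 g0 [N [mN N0 subN]].
rewrite (ge0_negligible_integral _ _ _ _ N0)//.
apply: (@le_trans _ _ (\int[mu]_(x in setT `\` N) g x)%E).
  apply: ge0_le_integral_gen => // x [_ Nx].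
  by apply: contrapT => fg; apply: Nx; exact: subN.
rewrite integral_mkcond; apply: ge0_le_integral_gen => x _.
  by rewrite patchE; case: ifP.
by rewrite patchE; case: ifP.
Qed.

End AeIntegral.

(** * Pathwise bounds for the entropy functional, the maximum and the oscillation *)

Section Walk.
Context {R : realType} {n : nat}.
Implicit Types (b t : {ffun 'I_n -> bool}) (i k : 'I_n) (g : 'I_n -> R).

Lemma GammaF_leaf_measure_le b : (0 < n)%N ->
  (GammaF (leaf_measure b) (sqdist (coefB b)) <= (20 * Num.sqrt n%:R)%:E :> \bar R)%E.
Proof.
move=> n0.
have n1 : 1 <= n%:R :> R by rewrite ler1n.
(* The 40 is the 20 of [leaf_count_ge] times 2 for the half of the mass on the leaves. *)
pose D : R := Num.sqrt (4 + n%:R); pose Q : R := Num.sqrt (40 * n.+1%:R).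
have D0 : 0 < D by rewrite sqrtr_gt0; lra.
have Q0 : 0 < Q by rewrite sqrtr_gt0 mulr_gt0.
have Q2 : Q ^+ 2 = 40 * n.+1%:R by rewrite sqr_sqrtr// mulr_ge0.
apply: le_trans (GammaF_le D0 Q0 (diam_coefB_le b) _) _ => [t r r0 rD|].
  apply: le_trans (ball_mass_leaf_ge b t r).
  have r2 : r ^+ 2 <= 4 + n%:R.
    rewrite -[leRHS]sqr_sqrtr; last by lra.
    by rewrite lerXn2r ?nnegrE// sqrtr_ge0.
  have := leaf_count_ge b t r0 r2; set S := \sum_(s < _) _ => hS.
  rewrite Q2 (_ : (1 + r) ^+ 2 / (40 * n.+1%:R)
    = 2^-1 * n.+1%:R^-1 * ((1 + r) ^+ 2 / 20)); last first.
    by field; rewrite addrC natr1 pnatr_eq0.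
  by rewrite ler_wpM2l// mulr_ge0// invr_ge0.
rewrite lee_fin -mulrA -sqrtrM; last by rewrite mulr_ge0// ltW.
pose s : R := Num.sqrt n%:R.
have s2 : s ^+ 2 = n%:R by rewrite sqr_sqrtr.
have s0 : 0 <= s by exact: sqrtr_ge0.
have s1 : 1 <= s by rewrite -sqrtr1 ler_wsqrtr.
have Qs : Q <= 9 * s.
  rewrite -[9 * s]ger0_norm ?mulr_ge0// -sqrtr_sqr ler_wsqrtr//.
  rewrite exprMn s2 -natr1; lra.
have Ds : D <= 3 * s.
  rewrite -[3 * s]ger0_norm ?mulr_ge0// -sqrtr_sqr ler_wsqrtr//.
  by rewrite exprMn s2; lra.
(* [2 Q (1 + D) <= 18 s * 4 s = 72 s^2]; the factor 2 in front then yields 20. *)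
have h : Num.sqrt (2 * Q * (1 + D)) <= 10 * s.
  rewrite -[10 * s]ger0_norm ?mulr_ge0// -sqrtr_sqr ler_wsqrtr//.
  by rewrite exprMn; nra.
by rewrite -/s; lra.
Qed.

(** The pattern [b] in the coding of [signT]; the value 0 is counted as positive. *)
Definition negbits g : {ffun 'I_n -> bool} := [ffun i => g i < 0].

Lemma signT_negbits g i : signT (negbits g) i * g i = `|g i|.
Proof. by rewrite /signT ffunE -normrEsign. Qed.

Lemma coefT_negbits g : (forall i, g i != 0) ->
  coefT g = coefB (negbits g) :> (_ -> 'I_n -> R).
Proof.
move=> g0; apply/funext => t; apply/funext => i; rewrite /coefT /coefB.
congr (_ * _); apply: eq_bigr => k _.
by rewrite ffunE /signT sgr_def g0 mulr1n (inj_eq (@signr_inj R)).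
Qed.

Lemma psum_lastE (T : finType) (a : T -> 'I_n -> R) g (t : T) :
  psum a g n t = \sum_(i < n) a t i * g i.
Proof. by rewrite /psum; apply: eq_bigl => i; rewrite ltn_ord. Qed.

Lemma psum_negbits g :
  psum (coefB (negbits g)) g n (negbits g) = \sum_(i < n) `|g i|.
Proof.
rewrite psum_lastE; apply: eq_bigr => i _.
by rewrite coefB_agree// signT_negbits.
Qed.

Lemma normr_coefT_le1 g t i : `|coefT g t i : R| <= 1.
Proof.
rewrite /coefT normrM normr_prod /signT normrX normrN1 expr1n mul1r.
by apply: prodr_ile1 => k _; case: (_ == _); rewrite ?normr1 ?normr0 ?ler01 ?lexx.
Qed.

(** The coefficients have modulus at most 1 even where some [g i] vanishes, so this bound has no
    exceptional event. *)
Lemma max_psum_coefT_le g :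
  \big[Num.max/0]_(t : {ffun 'I_n -> bool}) `|psum (coefT g) g n t|
  <= \sum_(i < n) `|g i|.
Proof.
apply: bigmax_le => [|t _]; first exact: sumr_ge0.
rewrite psum_lastE; apply: le_trans (ler_norm_sum _ _ _) _; apply: ler_sum => i _.
by rewrite normrM ler_piMl// normr_coefT_le1.
Qed.

Lemma max_psum_coefT_ge g : (forall i, g i != 0) ->
  \sum_(i < n) `|g i|
  <= \big[Num.max/0]_(t : {ffun 'I_n -> bool}) `|psum (coefT g) g n t|.
Proof.
move=> g0; apply: le_trans (le_bigmax _ _ (negbits g)).
by rewrite coefT_negbits// psum_negbits ler_norm.
Qed.

Lemma osc_ge (T : finType) (h : T -> R) (t u : T) : `|h t - h u| <= osc h.
Proof.
apply: le_trans (le_bigmax _ _ t).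
exact: (le_bigmax _ (fun u => `|h t - h u|) u).
Qed.

Lemma osc_ge0 (T : finType) (h : T -> R) : 0 <= osc h.
Proof. exact: bigmax_ge_id. Qed.

(** The path [b] collects all the [|g i|], while the path that disagrees at the first index stops
    there with a nonpositive sum. *)
Lemma osc_coefB_ge g : (0 < n)%N ->
  \sum_(i < n) `|g i| <= osc (psum (coefB (negbits g)) g n).
Proof.
move=> n0; apply: le_trans (osc_ge _ (negbits g) (flip (negbits g) 0)).
apply: le_trans (ler_norm _); rewrite psum_negbits lerBrDr gerDl.
rewrite psum_lastE; apply: sumr_le0 => i _; rewrite coefB_flip ltn0.
by case: ifP => _; rewrite ?mul0r// mulNr signT_negbits oppr_le0.
Qed.

End Walk.

(** * Measurability of functions of finitely many bits *)

Section Measurability.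
Context {R : realType}.

(** A preimage is a finite union, over bit patterns, of finite intersections of bit events and their
    complements. *)
Lemma sub_measurable_finite d (Omega : measurableType d) (G : set (set Omega)) (n : nat)
    (beta : 'I_n -> Omega -> bool) (phi : {ffun 'I_n -> bool} -> R) :
  sigma_algebra setT G -> (forall i, G (beta i @^-1` [set true])) ->
  sub_measurable G (fun w => phi [ffun i => beta i w]).
Proof.
move=> sG Gb _ [B mB <-].
have GE : G = <<s G >> by rewrite sigma_algebra_id.
pose T := g_sigma_algebraType G.
have mG (A : set Omega) : @measurable _ T A -> G A by rewrite [in X in _ -> X]GE.
have Gm (A : set Omega) : G A -> @measurable _ T A by move=> GA; rewrite /measurable/= -GE.
apply: mG; rewrite setTI.
rewrite (_ : _ @^-1` B = \bigcup_(b in [set b | B (phi b)])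
   \bigcap_(i in [set: 'I_n]) (beta i @^-1` [set b i])); last first.
  apply/seteqP; split=> w /=.
    by move=> Bw; exists [ffun i => beta i w] => // i _ /=; rewrite ffunE.
  move=> [b /= Bb wb]; rewrite (_ : [ffun i => _] = b)//.
  by apply/ffunP => i; rewrite ffunE; exact: wb.
apply: fin_bigcup_measurable => // b _.
apply: fin_bigcap_measurable => // i _.
have [bi|/negbTE bi] := boolP (b i); rewrite ?bi; first exact: Gm.
rewrite (_ : _ @^-1` _ = ~` (beta i @^-1` [set true])); last first.
  by apply/seteqP; split=> w /=; case: (beta i w).
by apply: measurableC; exact: Gm.
Qed.

End Measurability.

(** * Nonvanishing and total absolute mass of a Gaussian family *)

Section Gaussians.
Context {R : realType} {n : nat} d (Omega : measurableType d).
Variables (P : probability Omega R) (g : 'I_n -> {RV P >-> R}).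
Hypothesis gauss : forall i, std_gaussian (g i).

Lemma ae_gaussian_neq0 : {ae P, forall w, forall i, g i w != 0}.
Proof.
apply: filter_forall => i; exists (g i @^-1` [set 0]); split.
- by rewrite -[X in measurable X]setTI; exact: measurable_funPT.
- exact: gaussian_neq0.
- by move=> w /= /negP; rewrite negbK => /eqP.
Qed.

Lemma measurable_sum_abs :
  measurable_fun [set: Omega] (fun w => (\sum_(i < n) `|g i w|)%:E).
Proof.
apply/measurable_EFinP; apply: measurable_sum => i.
by apply: measurableT_comp => //; exact: measurable_funPT.
Qed.

Lemma expectation_sum_abs_gaussian :
  (\int[P]_w (\sum_(i < n) `|g i w|)%:E = (Num.sqrt (2 / pi) * n%:R)%:E)%E.
Proof.
under eq_integral do rewrite -sumEFin.
rewrite ge0_integral_sum//; last first.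
  move=> i; apply/measurable_EFinP.
  by apply: measurableT_comp => //; exact: measurable_funPT.
under eq_bigr do rewrite expectation_abs_gaussian//.
by rewrite sumEFin sumr_const card_ord mulr_natr.
Qed.

End Gaussians.

(** * Expectations, the random measure, and failure of a universal bound *)

Section Parts.
Context {R : realType}.

(** Everything is compared with the sum of the [|g i|]: from above at every outcome, from below
    where no [g i] vanishes. *)
Lemma expectations_of_walk (n : nat) d (Omega : measurableType d)
    (P : probability Omega R) (g : 'I_n -> {RV P >-> R}) :
  (0 < n)%N -> (forall i, std_gaussian (g i)) ->
  let X := fun (w : Omega) (j : nat) (theta : {ffun 'I_n -> bool}) =>
    psum (coefT (fun i => g i w)) (fun i => g i w) j theta in
  ('E_P[fun w =>
      (\big[Num.max/0]_(theta : {ffun 'I_n -> bool}) `|X w n theta|)%R]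
    = (Num.sqrt (2 / pi) * n%:R)%:E)%E /\
  ((Num.sqrt (2 / pi) * n%:R)%:E <= 'E_P[fun w => osc (X w n)])%E.
Proof.
move=> n0 gauss X; rewrite -(expectation_sum_abs_gaussian gauss) unlock.
have S0 w : (0 <= (\sum_(i < n) `|g i w|)%:E)%E by rewrite lee_fin sumr_ge0.
have M0 w : (0 <= (\big[Num.max/0]_(t : {ffun 'I_n -> bool}) `|X w n t|)%:E)%E.
  by rewrite lee_fin bigmax_ge_id.
split; last first.
  apply: ae_ge0_le_integral_gen => //.
  - exact: measurable_sum_abs.
  - by move=> w; rewrite lee_fin osc_ge0.
  apply: filterS (ae_gaussian_neq0 gauss) => w gw0.
  by rewrite lee_fin /X coefT_negbits//; exact: osc_coefB_ge.
apply/eqP; rewrite eq_le; apply/andP; split.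
  by apply: ge0_le_integral_gen => // w _; rewrite lee_fin; exact: max_psum_coefT_le.
apply: ae_ge0_le_integral_gen => //; first exact: measurable_sum_abs.
apply: filterS (ae_gaussian_neq0 gauss) => w gw0.
by rewrite lee_fin; exact: max_psum_coefT_ge.
Qed.

Lemma negbits_sub_measurable d (Omega : measurableType d) (P : probability Omega R)
    (G : set (set Omega)) n (g : 'I_n -> {RV P >-> R})
    (phi : {ffun 'I_n -> bool} -> R) :
  sigma_algebra setT G -> (forall i, sub_measurable G (g i)) ->
  sub_measurable G (fun w => phi (negbits (fun i => g i w))).
Proof.
move=> sG mg; apply: (sub_measurable_finite (beta := fun i w => g i w < 0)) => // i.
apply: (mg i); exists (`]-oo, 0[%classic : set R); first exact: measurable_itv.
by rewrite setTI; apply/seteqP; split=> w /=; rewrite in_itv.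
Qed.

Lemma random_measure_of_walk (n : nat) d (Omega : measurableType d)
    (P : probability Omega R) (g : 'I_n -> {RV P >-> R}) :
  (0 < n)%N -> (forall i, std_gaussian (g i)) ->
  exists mu : Omega -> {ffun 'I_n -> bool} -> R,
    [/\ forall w, full_support_prob (mu w),
        forall theta, sub_measurable (g_sigma_preimage (fun i => g i : Omega -> R))
          (fun w => mu w theta) &
        {ae P, forall w,
          (GammaF (mu w) (sqdist (coefT (fun i => g i w)))
            <= (20 * Num.sqrt n%:R)%:E)%E}].
Proof.
move=> n0 gauss; exists (fun w => leaf_measure (negbits (fun i => g i w))); split.
- by move=> w; exact: leaf_measure_full_support.
- move=> theta.
  apply: (negbits_sub_measurable (phi := fun b => leaf_measure b theta)).
    exact: smallest_sigma_algebra.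
  move=> i A mA; apply: sub_sigma_algebra.
  by rewrite (bigD1 i)//=; left.
- apply: filterS (ae_gaussian_neq0 gauss) => w gw0.
  by rewrite coefT_negbits//; exact: GammaF_leaf_measure_le.
Qed.

Lemma coefB_congr n (b b' t : {ffun 'I_n -> bool}) (i : 'I_n) :
  (forall k : 'I_n, (k < i)%N -> b k = b' k) ->
  coefB b t i = coefB b' t i :> R.
Proof. by move=> bb'; rewrite /coefB; congr (_ * _); apply: eq_bigr => k /bb' ->. Qed.

(** Coefficient [i] reads only the signs at [k < i], and these are known at time [k + 1 <= i]. *)
Lemma walk_predictable (n : nat) d (Omega : measurableType d)
    (P : probability Omega R) (F : nat -> set (set Omega)) (g : nat -> {RV P >-> R}) :
  gaussian_model n F g ->
  predictable_gaussian_sums F (fun i : 'I_n => g i)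
    (fun t i w => coefB (negbits (fun k : 'I_n => g k w)) t i).
Proof.
move=> [Ffil gF]; split=> //.
- by move=> i; have [] := gF i (ltn_ord i).
- by move=> i; have [] := gF i (ltn_ord i).
- by move=> i; have [] := gF i (ltn_ord i).
move=> t i; have [Fsig Fle] := Ffil.
(* Bits from [i] on are masked to [false], which leaves the coefficient unchanged and makes every
   remaining bit an event of [F i]. *)
rewrite (_ : (fun w => _) = (fun w : Omega =>
    coefB [ffun k : 'I_n => (k < i)%N && (g k w < 0)] t i)); last first.
  by apply/funext => w; apply: coefB_congr => k ki; rewrite !ffunE ki.
have iN : (i <= n)%N by apply: ltnW.
apply: (sub_measurable_finite (beta := fun k w => (k < i)%N && (g k w < 0))
  (phi := fun b => coefB b t i)); first exact: (Fsig i iN).1.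
move=> k; have [ki|ik] := ltnP k i.
  have [_ _ mgk] := gF k (ltn_ord k).
  apply: (Fle k.+1) => //; apply: mgk.
  exists (`]-oo, 0[%classic : set R); first exact: measurable_itv.
  by rewrite setTI; apply/seteqP; split=> w /=; rewrite in_itv.
rewrite (_ : _ @^-1` _ = set0); last by apply/seteqP; split.
by have [[]] := Fsig i iN.
Qed.

Lemma no_universal_constant :
  ~ (exists C : R,
    forall (d : measure_display) (Omega : measurableType d)
      (P : probability Omega R) (N : nat) (T : finType)
      (F : nat -> set (set Omega)) (g : 'I_N -> {RV P >-> R})
      (A : T -> 'I_N -> Omega -> R),
    (0 < #|T|)%N ->
    predictable_gaussian_sums F g A ->
    ('E_P[fun w =>
        (\big[Num.max/0]_(j < N.+1)
           osc (psum (fun t i => A t i w) (fun i => g i w) j))%R]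
      <= C%:E * \int[P]_w
           ereal_inf [set GammaF m (sqdist (fun t i => A t i w))
                     | m in full_support_prob])%E).
Proof.
move=> [C hC].
pose c : R := Num.sqrt (2 / pi).
have c0 : 0 < c by rewrite sqrtr_gt0 divr_gt0// pi_gt0.
suff main n : (0 < n)%N -> c * n%:R <= `|C| * (20 * Num.sqrt n%:R).
  pose K := `|C| * 20 / c.
  (* The inequality [main n] amounts to [sqrt n <= K], so any [n > K^2] contradicts it. *)
  pose n := (Num.truncn (K ^+ 2)).+1.
  have := main n isT; pose s : R := Num.sqrt n%:R; rewrite -/s.
  have s2 : s ^+ 2 = n%:R by rewrite sqr_sqrtr.
  have s0 : 0 < s by rewrite sqrtr_gt0 ltr0n.
  have K0 : 0 <= K by rewrite /K !mulr_ge0// invr_ge0 ltW.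
  have Kn : K ^+ 2 < s ^+ 2 by rewrite s2; apply: truncnS_gt.
  have Ks : K < s by rewrite -(@ltr_pXn2r _ 2)// nnegrE// ltW.
  have CK : `|C| * 20 = K * c by rewrite divfK// gt_eqF.
  rewrite mulrA CK -s2 expr2 mulrA ler_pM2r// mulrC ler_pM2r//.
  by rewrite leNgt Ks.
move=> n0.
case: (@gaussian_model_exists R n) => d; case=> Omega; case=> P; case=> F; case=> g model.
pose b w : {ffun 'I_n -> bool} := negbits (fun k : 'I_n => g k w).
(* With [coefB] in place of [coefT] the pathwise bounds hold at every outcome. *)
pose A := fun t i w => coefB (b w) t i : R.
have gauss (i : 'I_n) : std_gaussian (g i) by have [_ /(_ i (ltn_ord i))[]] := model.
have := hC _ _ _ _ _ _ _ _ _ (walk_predictable model).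
have -> : (0 < #|{ffun 'I_n -> bool}|)%N by apply/card_gt0P; exists [ffun=> true].
move=> /(_ isT); rewrite unlock => hle.
have low : ((c * n%:R)%:E <= \int[P]_w
    (\big[Num.max/0]_(j < n.+1)
       osc (psum (fun t i => A t i w) (fun i : 'I_n => g i w) j))%:E)%E.
  rewrite -(expectation_sum_abs_gaussian gauss).
  apply: ge0_le_integral_gen => w _; rewrite lee_fin ?sumr_ge0//.
  (* The terminal time alone gives the lower bound. *)
  apply: le_trans (le_bigmax _ _ ord_max).
  exact: osc_coefB_ge.
pose I := (\int[P]_w ereal_inf [set GammaF m (sqdist (fun t i => A t i w))
                     | m in full_support_prob])%E.
have inf0 w : (0 <= ereal_inf [set GammaF m (sqdist (fun t i => A t i w))
                     | m in full_support_prob] :> \bar R)%E.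
  apply: le_ereal_inf_tmp => _ [m _ <-].
  apply: (@le_trans _ _ (\int[lebesgue_measure]_(r in `[0%R, diam (sqdist (fun t i => A t i w))])
      (Num.sqrt (ln (expR 1 / ball_mass m (sqdist (fun t i => A t i w)) (b w) r)))%:E)%E).
    by apply: integral_ge0 => r _; rewrite lee_fin sqrtr_ge0.
  by apply: ereal_sup_ubound; exists (b w).
have I0 : (0 <= I)%E by apply: integral_ge0.
have I1 : (I <= (20 * Num.sqrt n%:R)%:E)%E.
  apply: (@le_trans _ _ (\int[P]_w (20 * Num.sqrt n%:R)%:E)%E).
    apply: ge0_le_integral_gen => w _ //.
    apply: le_trans (GammaF_leaf_measure_le (b w) n0).
    apply: ereal_inf_lbound; exists (leaf_measure (b w)) => //.
    exact: leaf_measure_full_support.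
  rewrite integral_cst// [X in (_ * X)%E](_ : _ = 1%E) ?mule1//.
  exact: (probability_setT P).
rewrite -lee_fin; apply: le_trans (le_trans low hle) _.
(* [C] may be negative; since [I] is nonnegative, it can be replaced by its absolute value. *)
rewrite -/I EFinM; apply: (@le_trans _ _ (`|C|%:E * I)%E).
  by apply: lee_wpmul2r => //; rewrite lee_fin ler_norm.
by apply: lee_wpmul2l.
Qed.

End Parts.

Theorem mainTheorem14 (R : realType) :
  (forall (n : nat) (d : measure_display) (Omega : measurableType d)
      (P : probability Omega R) (g : 'I_n -> {RV P >-> R}),
    (1 <= n)%N ->
    (forall i, std_gaussian (g i)) -> mutually_independent g ->
    let X := fun (w : Omega) (j : nat) (theta : {ffun 'I_n -> bool}) =>
      psum (coefT (fun i => g i w)) (fun i => g i w) j theta in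
    ('E_P[fun w =>
        (\big[Num.max/0]_(theta : {ffun 'I_n -> bool}) `|X w n theta|)%R]
      = (Num.sqrt (2 / pi) * n%:R)%:E)%E /\
    ((Num.sqrt (2 / pi) * n%:R)%:E <= 'E_P[fun w => osc (X w n)])%E)
  /\
  (exists C' : R,
    forall (n : nat) (d : measure_display) (Omega : measurableType d)
      (P : probability Omega R) (g : 'I_n -> {RV P >-> R}),
    (1 <= n)%N ->
    (forall i, std_gaussian (g i)) -> mutually_independent g ->
    exists mu : Omega -> {ffun 'I_n -> bool} -> R,
      [/\ forall w, full_support_prob (mu w),
          forall theta, sub_measurable (g_sigma_preimage (fun i => g i : Omega -> R))
            (fun w => mu w theta) &
          {ae P, forall w,
            (GammaF (mu w) (sqdist (coefT (fun i => g i w)))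
              <= (C' * Num.sqrt n%:R)%:E)%E}])
  /\
  ~ (exists C : R,
    forall (d : measure_display) (Omega : measurableType d)
      (P : probability Omega R) (N : nat) (T : finType)
      (F : nat -> set (set Omega)) (g : 'I_N -> {RV P >-> R})
      (A : T -> 'I_N -> Omega -> R),
    (0 < #|T|)%N ->
    predictable_gaussian_sums F g A ->
    ('E_P[fun w => 
        (\big[Num.max/0]_(j < N.+1)
           osc (psum (fun t i => A t i w) (fun i => g i w) j))%R]
      <= C%:E * \int[P]_w
           ereal_inf [set GammaF m (sqdist (fun t i => A t i w))
                     | m in full_support_prob])%E).
Proof.
split; first by move=> n d Omega P g n0 gauss _; exact: expectations_of_walk.
split; last exact: no_universal_constant.
by exists 20 => n d Omega P g n0 gauss _; exact: random_measure_of_walk.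
Qed.
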